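(* Let $p$ be a prime and let $G$ be a finite noncyclic $p$-group. If $K$ is a homomorphic image of $G$ such that $K$ is not powerful, then $\sigma_P(K) \leq \sigma_P(G)$.
   Context: For a group $G$ and a positive integer $k$, $G^k$ denotes the subgroup generated by $\{g^k \mid g\in G\}$, and $[G,G]$ is the commutator subgroup. A finite $p$-group $G$ ($p$ prime) is called powerful if either $p$ is odd and $[G,G]\subseteq G^p$, or $p=2$ and $[G,G]\subseteq G^4$. A cover of a group $G$ is a collection of proper subgroups of $G$ whose union is $G$. A powerful cover of a finite $p$-group $G$ is a cover of $G$ all of whose members are powerful groups. The powerful covering number $\sigma_P(G)$ of a finite noncyclic $p$-group $G$ is the smallest number of subgroups in a powerful cover of $G$. *)

(* Defs.v *)
From HB Require Import structures.
From mathcomp Require Import all_boot all_fingroup all_solvable.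

Set Implicit Arguments.
Unset Strict Implicit.
Unset Printing Implicit Defensive.

Local Open Scope group_scope.

Definition power_subgroup (gT : finGroupType) (k : nat) (G : {set gT}) :
    {set gT} :=
  <<[set x ^+ k | x in G]>>.

Definition powerful (p : nat) (gT : finGroupType) (G : {set gT}) : bool :=
  p.-group G && ([~: G, G] \subset power_subgroup (if p == 2 then 4 else p) G).

Definition group_cover (gT : finGroupType) (G : {set gT})
    (C : {set {group gT}}) : bool :=
  [forall H in C, H \proper G] && (\bigcup_(H in C) H == G).

Definition powerful_cover (p : nat) (gT : finGroupType) (G : {set gT})
    (C : {set {group gT}}) : bool :=
  group_cover G C && [forall H in C, powerful p H].

(* The second argument of the [arg min] below must itself be a powerful cover;
   the set of cyclic subgroups is one as soon as G is a noncyclic p-group. *)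
Definition cyclic_subgroups (gT : finGroupType) (G : {set gT}) :
    {set {group gT}} :=
  [set <[x]>%G | x in G].

(* Only meaningful for noncyclic p-groups: a cyclic group has no cover, and the
   value is then arbitrary (see sigmaP_cover and sigmaP_min). *)
Definition sigmaP (p : nat) (gT : finGroupType) (G : {set gT}) : nat :=
  #|[arg min_(C < cyclic_subgroups G | powerful_cover p G C) #|C|]|.

Lemma abelian_powerful (p : nat) (gT : finGroupType) (G : {group gT}) :
  p.-group G -> abelian G -> powerful p G.
Proof.
by move=> pG; rewrite /powerful pG => /commG1P ->; exact: sub1G.
Qed.

Lemma cyclic_subgroups_cover (p : nat) (gT : finGroupType) (G : {group gT}) :
  p.-group G -> ~~ cyclic G -> powerful_cover p G (cyclic_subgroups G).
Proof.
move=> pG ncG; apply/andP; split; first (apply/andP; split).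
- apply/forall_inP => _ /imsetP[x Gx ->] /=.
  rewrite properEneq cycle_subG Gx andbT.
  by apply: contraNneq ncG => <-; exact: cycle_cyclic.
- rewrite eqEsubset; apply/andP; split.
    by apply/bigcupsP => _ /imsetP[x Gx ->]; rewrite cycle_subG.
  apply/subsetP => x Gx; apply/bigcupP; exists <[x]>%G; last exact: cycle_id.
  exact: imset_f.
apply/forall_inP => _ /imsetP[x Gx ->].
apply: abelian_powerful; last exact: cycle_abelian.
by apply: pgroupS pG; rewrite cycle_subG.
Qed.

Lemma sigmaP_cover (p : nat) (gT : finGroupType) (G : {group gT}) :
  p.-group G -> ~~ cyclic G ->
  exists2 C : {set {group gT}}, powerful_cover p G C & #|C| = sigmaP p G.
Proof.
move=> pG ncG; rewrite /sigmaP.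
by case: arg_minnP => [|C covC _]; [exact: cyclic_subgroups_cover | exists C].
Qed.

Lemma sigmaP_min (p : nat) (gT : finGroupType) (G : {group gT})
    (C : {set {group gT}}) :
  p.-group G -> ~~ cyclic G -> powerful_cover p G C -> sigmaP p G <= #|C|.
Proof.
move=> pG ncG covC; rewrite /sigmaP.
by case: arg_minnP => [|D _]; [exact: cyclic_subgroups_cover | exact].
Qed.

(* Main.v *)
Require Import Defs.
From HB Require Import structures.
From mathcomp Require Import all_boot all_fingroup all_solvable.

(** A quotient of a powerful p-group is powerful, because a morphism carries
    commutators to commutators and k-th powers to k-th powers
    ([morphim_powerful]). Push a minimal powerful cover of G forward along a
    surjection from G onto K. The images are powerful and their union is K;
    each is a proper subgroup because K itself is not powerful
    ([morphim_powerful_cover]). So they form a powerful cover of K with at most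
    as many members. Since cyclic p-groups are powerful, K is noncyclic, and
    hence its covering number is a minimum over all its powerful covers, this
    one included. *)

Set Implicit Arguments.
Unset Strict Implicit.
Unset Printing Implicit Defensive.

Local Open Scope group_scope.

Lemma morphim_power_subgroup (aT rT : finGroupType) (D : {group aT})
    (f : {morphism D >-> rT}) (k : nat) (H : {group aT}) :
  H \subset D -> f @* power_subgroup k H = power_subgroup k (f @* H).
Proof.
move=> sHD; have sPD : [set x ^+ k | x in H] \subset D.
  by apply/subsetP => _ /imsetP[x Hx ->]; rewrite groupX // (subsetP sHD).
rewrite /power_subgroup morphim_gen //; congr <<_>>.
rewrite (morphimEsub f sPD) (morphimEsub f sHD) -!imset_comp.
by apply: eq_in_imset => x Hx /=; rewrite morphX // (subsetP sHD).
Qed.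

Lemma morphim_powerful (p : nat) (aT rT : finGroupType) (D : {group aT})
    (f : {morphism D >-> rT}) (H : {group aT}) :
  H \subset D -> powerful p H -> powerful p (f @* H).
Proof.
move=> sHD /andP[pH sH'P]; rewrite /powerful morphim_pgroup //=.
by rewrite -morphimR // -morphim_power_subgroup // morphimS.
Qed.

(** Properness of the images is the only delicate point: a proper subgroup H
    can map onto [f @* G], for instance when H is a proper supplement of the
    kernel of [f]. A powerful H cannot do so, since [f @* H] is powerful and
    [f @* G] is not. *)
Lemma morphim_powerful_cover (p : nat) (aT rT : finGroupType)
    (G : {group aT}) (f : {morphism G >-> rT}) (C : {set {group aT}}) :
  ~~ powerful p (f @* G) -> powerful_cover p G C ->
  powerful_cover p (f @* G) [set (f @* H)%G | H : {group aT} in C].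
Proof.
move=> npfG /andP[/andP[/forall_inP prC /eqP unC] /forall_inP powC].
have sCG H : H \in C -> H \subset G by move/prC/proper_sub.
have powfC H : H \in C -> powerful p (f @* H).
  by move=> CH; apply: morphim_powerful (sCG H CH) (powC H CH).
apply/andP; split; first (apply/andP; split).
- apply/forall_inP => _ /imsetP[H CH ->] /=.
  rewrite properEneq morphimS ?sCG // andbT.
  by apply: contraNneq npfG => <-; exact: powfC.
- rewrite eqEsubset; apply/andP; split.
    by apply/bigcupsP => _ /imsetP[H CH ->]; rewrite morphimS ?sCG.
  apply/subsetP => _ /morphimP[x Gx _ ->].
  have /bigcupP[H CH Hx] : x \in \bigcup_(H in C) H by rewrite unC.
  by apply/bigcupP; exists (f @* H)%G; [exact: imset_f | exact: mem_morphim].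
by apply/forall_inP => _ /imsetP[H CH ->]; exact: powfC.
Qed.

Theorem theorem3p3 (p : nat) (gT rT : finGroupType)
    (G : {group gT}) (K : {group rT})
    (p_prime : prime p) (pG : p.-group G) (ncG : ~~ cyclic G)
    (homKG : K \homg G) (npK : ~~ powerful p K) :
  sigmaP p K <= sigmaP p G.
Proof.
have [f fG] := homgP homKG.
have pK : p.-group K by rewrite -fG morphim_pgroup.
have ncK : ~~ cyclic K.
  by apply: contra npK => /cyclic_abelian; exact: abelian_powerful.
have [C covC <-] := sigmaP_cover pG ncG.
apply: leq_trans (leq_imset_card (fun H : {group gT} => (f @* H)%G) C).
apply: sigmaP_min => //.
by rewrite -fG; apply: morphim_powerful_cover covC; rewrite fG.
Qed.
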